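(* Let $K$ be an arbitrary field, and let $N=R\oplus M$ be the Novikov algebra over $K$ that is the zero split extension of $R$ by $M$, where $R=KE_{-1}\oplus KE_0$ is the two-dimensional subalgebra of the Novikov algebra $L=\bigoplus_{i\ge -1}KE_i$ with product $E_i\circ E_j=\binom{i+j+1}{i+1}E_{i+j}$, and $M=\bigoplus_{i\ge -1}KF_i$ is an isomorphic copy of $L$ regarded as an $R$-bimodule. Then $N$ is Lie-solvable of index $3$, and $[N,N]$ is not nilpotent.
   Context: Algebras are not necessarily associative. A Novikov algebra over $K$ is a $K$-vector space with a bilinear product satisfying $(x,y,z)=(y,x,z)$ and $(xy)z=(xz)y$, where $(x,y,z)=(xy)z-x(yz)$. Binomial coefficients are $\binom{n}{k}=\frac{n!}{k!(n-k)!}$ for integers $n\ge k\ge 0$, with the convention $\binom{n}{k}=0$ if $n<k$; they are viewed as elements of $K$. $L$ is the algebra over $K$ with linear basis $E_{-1},E_0,E_1,\ldots$ and product $E_i\circ E_j=\binom{i+j+1}{i+1}E_{i+j}$ for all $i,j\ge -1$ (terms with coefficient $0$ are $0$; in particular $E_{-1}\circ E_{-1}=0$); it is a Novikov algebra. $M$ is a vector space with basis $F_i$, $i\ge -1$, with $R$-bimodule structure $E_i\circ F_j=\binom{i+j+1}{i+1}F_{i+j}$ and $F_j\circ E_i=\binom{i+j+1}{j+1}F_{i+j}$ for $i\in\{-1,0\}$, $j\ge -1$. The zero split extension of $R$ by $M$ is the vector space $N=R\oplus M$ with product $(r_1+m_1)(r_2+m_2)=r_1\circ r_2+r_1\circ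 m_2+m_1\circ r_2$ for $r_1,r_2\in R$, $m_1,m_2\in M$; it is a Novikov algebra. For a Novikov algebra $N$, the commutator $[x,y]=xy-yx$ makes $N$ a Lie algebra $N^{(-)}$. $N$ is Lie-solvable of index $n$ if $N^{(-)}$ is solvable and $n$ is the least integer such that the $n$-th term of its derived series vanishes, the series being $\mathfrak g^{(0)}=\mathfrak g$, $\mathfrak g^{(m+1)}=[\mathfrak g^{(m)},\mathfrak g^{(m)}]$. $[N,N]$ is the linear span of all commutators, regarded as an algebra under the product of $N$. For an algebra $A$, put $A^1=A$ and $A^m=\sum_{i=1}^{m-1}A^iA^{m-i}$ for $m\ge 2$; $A$ is nilpotent if $A^m=0$ for some positive integer $m$. *)

(* Defs.v *)
From HB Require Import structures.
From mathcomp Require Import all_boot all_order all_algebra.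
From mathcomp Require Import classical_sets ring.

Set Implicit Arguments.
Unset Strict Implicit.
Unset Printing Implicit Defensive.

Import GRing.Theory Num.Theory.
Local Open Scope ring_scope.
Local Open Scope classical_set_scope.

Record algebra (K : fieldType) := Algebra {
  carrier :> lmodType K;
  amul : carrier -> carrier -> carrier;
  amul_linearr : forall x, linear (amul x);
  amul_linearl : forall y, linear (amul^~ y) }.

Section Algebras.
Variables (K : fieldType) (A : algebra K).
Implicit Types (x y z : A) (B C : set A).

Definition associator x y z : A := amul (amul x y) z - amul x (amul y z).

Definition is_novikov : Prop :=
  (forall x y z, associator x y z = associator y x z) /\
  (forall x y z, amul (amul x y) z = amul (amul x z) y).

Definition is_lie : Prop :=
  (forall x, amul x x = 0) /\
  (forall x y z, amul (amul x y) z + amul (amul y z) x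
                 + amul (amul z x) y = 0).

Definition commutator x y : A := amul x y - amul y x.

Fact commutator_linearr x : linear (commutator x).
Proof.
move=> a y z; rewrite /commutator amul_linearr amul_linearl.
by rewrite scalerBr addrACA opprD.
Qed.

Fact commutator_linearl y : linear (commutator^~ y).
Proof.
move=> a x z; rewrite /commutator amul_linearr amul_linearl.
by rewrite scalerBr addrACA opprD.
Qed.

Definition commutator_algebra : algebra K :=
  Algebra commutator_linearr commutator_linearl.

Definition lspan (S : set A) : set A :=
  [set x | exists2 s : seq (K * A), (forall p, p \in s -> S p.2)
                                  & x = \sum_(p <- s) p.1 *: p.2].

Definition sprod B C : set A := lspan [set amul x y | x in B & y in C].

Fixpoint derived (n : nat) : set A :=
  if n is m.+1 then sprod (derived m) (derived m) else setT.

Definition solvable_of_index (n : nat) : Prop :=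
  derived n = [set 0] /\ forall m, derived m = [set 0] -> (n <= m)%N.

Definition sum_of_products (P : nat -> set A) (m : nat) : set A :=
  [set x | exists2 u : nat -> A,
     (forall i, (0 < i < m)%N -> sprod (P i) (P (m - i)%N) (u i))
     & x = \sum_(1 <= i < m) u i].

(* [pow_table B n m] is B^m for 1 <= m <= n + 1; the table is there only to
   make the course-of-values recursion structural, see [apow1] and [apowE]. *)
Fixpoint pow_table B (n : nat) : nat -> set A :=
  if n is k.+1 then
    fun m => if (m <= k.+1)%N then pow_table B k m
             else sum_of_products (pow_table B k) m
  else fun=> B.

Definition apow B (m : nat) : set A := pow_table B m.-1 m.

Lemma apow1 B : apow B 1 = B. Proof. by []. Qed.

Lemma pow_tableE B n m : (0 < m <= n.+1)%N -> pow_table B n m = apow B m.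
Proof.
elim: n => [|n IHn] /andP[m0 mn].
  by have -> : m = 1%N by apply/eqP; rewrite eqn_leq mn.
rewrite /=; case: ifPn => [mn1|]; first by rewrite IHn ?m0.
rewrite -ltnNge => nm; have -> : m = n.+2 by apply/eqP; rewrite eqn_leq mn.
by rewrite /apow /= ltnn.
Qed.

Lemma apowE B m : (1 < m)%N -> apow B m = sum_of_products (apow B) m.
Proof.
case: m => [|[|m]] // _; rewrite {1}/apow /= ltnn /sum_of_products.
apply/seteqP; split=> x [u uP ->]; exists u => // i im; have := uP i im;
  have /andP[i0 im2] := im;
  by rewrite !pow_tableE ?i0 ?subn_gt0 ?im2 //= leq_subLR -add1n leq_add2r.
Qed.

(* [B] is meant to be a subspace closed under the product of [A], that is an
   algebra for the product of [A]; its powers as such are computed in [A]. *)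
Definition nilpotent B : Prop :=
  exists2 m : nat, (0 < m)%N & apow B m = [set 0].

Definition commutator_span : set A :=
  lspan [set commutator x y | x in setT & y in setT].

End Algebras.

Arguments commutator_span {K} A _.

Record novikovAlgebra (K : fieldType) := NovikovAlgebra {
  novikov_algebra :> algebra K;
  novikovP : is_novikov novikov_algebra }.

Section NovikovLie.
Variables (K : fieldType) (A : novikovAlgebra K).
Implicit Types x y z : A.

Lemma amulBr x y z : amul x (y - z) = amul x y - amul x z.
Proof.
by have := amul_linearr x (-1) z y; rewrite !scaleN1r [- z + y]addrC => ->;
  rewrite addrC.
Qed.

Lemma amulBl x y z : amul (y - z) x = amul y x - amul z x.
Proof.
by have /= := amul_linearl x (-1) z y; rewrite !scaleN1r [- z + y]addrC => ->;
  rewrite addrC.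
Qed.

Lemma amul_commutatorl x y z :
  amul (commutator x y) z = amul x (amul y z) - amul y (amul x z).
Proof.
have := (novikovP A).1 x y z; rewrite /associator amulBl => /eqP.
rewrite subr_eq => /eqP ->.
by rewrite addrAC [_ - _ - _]addrAC subrr add0r addrC.
Qed.

Lemma commutator_algebra_lie : is_lie (commutator_algebra A).
Proof.
split=> [x|x y z] /=; first by rewrite /commutator subrr.
have E (u v w : A) : commutator (commutator u v) w
    = amul u (amul v w) - amul v (amul u w)
      - (amul w (amul u v) - amul w (amul v u)).
  by rewrite -amulBr -/(commutator u v) -amul_commutatorl.
rewrite !E.
have zsum (a b c d e f : A) :
  a - b - (c - d) + (e - d - (a - f)) + (c - f - (e - b)) = 0.
  rewrite !opprB !addrA.
  rewrite [LHS](ACl ((1*8)*(11*2)*(3*6)*(9*4)*(5*12)*(7*10)))%AC /=.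
  by rewrite !subrr !addr0.
exact: zsum.
Qed.

End NovikovLie.

Definition lie_solvable_of_index (K : fieldType) (A : novikovAlgebra K) n :=
  solvable_of_index (commutator_algebra A) n.

Lemma poly_linear_ext (K : fieldType) (V : lmodType K) (f g : {poly K} -> V) :
  linear f -> linear g -> (forall n, f 'X^n = g 'X^n) -> f =1 g.
Proof.
move=> fL gL fg p.
pose F := GRing.isLinear.Build K {poly K} V _ f fL.
pose G := GRing.isLinear.Build K {poly K} V _ g gL.
pose f' : {linear {poly K} -> V} := HB.pack f F.
pose g' : {linear {poly K} -> V} := HB.pack g G.
rewrite -[f]/(f' : _ -> _) -[g]/(g' : _ -> _) -[p]coefK poly_def !linear_sum.
by apply: eq_bigr => i _; rewrite !linearZ /= fg.
Qed.

Section L.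
Variable K : fieldType.

(* In the structure constants of L the lower argument i + 1 is never negative
   and the upper one is negative, equal to -1, only for E_(-1) o E_(-1), where
   the coefficient is 0 ('C(0.-1, 0) on nat would be 1). *)
Definition binz (n k : int) : nat :=
  match n, k with Posz n', Posz k' => 'C(n', k') | _, _ => 0%N end.

(* The vector space of L is {poly K}, with 'X^n standing for E_(n - 1); the
   ring structure of {poly K} plays no role.  E_i only occurs with a zero
   coefficient when i < -1. *)
Definition E (i : int) : {poly K} :=
  if i + 1 is Posz n then 'X^n else 0.

Definition basis_mul (i j : int) : {poly K} :=
  (binz (i + j + 1) (i + 1))%:R *: E (i + j).

Definition L_mul (p q : {poly K}) : {poly K} :=
  \sum_(a < size p) \sum_(b < size q)
    (p`_a * q`_b) *: basis_mul (a%:Z - 1) (b%:Z - 1).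

Definition lext (V : lmodType K) (f : nat -> V) (p : {poly K}) : V :=
  \sum_(a < size p) p`_a *: f a.

Lemma lextE (V : lmodType K) (f : nat -> V) n (p : {poly K}) :
  (size p <= n)%N -> lext f p = \sum_(a < n) p`_a *: f a.
Proof.
move=> pn; rewrite /lext (big_ord_widen n (fun a => p`_a *: f a)) // big_mkcond.
apply: eq_bigr => i _; case: ltnP => // pi; by rewrite nth_default // scale0r.
Qed.

Lemma lext_linear (V : lmodType K) (f : nat -> V) : linear (lext f).
Proof.
move=> c p q; pose n := maxn (size (c *: p + q)) (maxn (size p) (size q)).
rewrite !(@lextE _ _ n) ?leq_max ?leqnn ?orbT // scaler_sumr -big_split /=.
by apply: eq_bigr => i _; rewrite coefD coefZ scalerDl scalerA.
Qed.

Lemma lextX (V : lmodType K) (f : nat -> V) n : lext f 'X^n = f n.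
Proof.
rewrite /lext size_polyXn big_ord_recr /= coefXn eqxx scale1r big1 ?add0r //.
by move=> i _; rewrite coefXn ltn_eqF // scale0r.
Qed.

Lemma L_mulE p q :
  L_mul p q =
  lext (fun a => lext (fun b => basis_mul (a%:Z - 1) (b%:Z - 1)) q) p.
Proof.
rewrite /L_mul /lext; apply: eq_bigr => a _; rewrite scaler_sumr.
by apply: eq_bigr => b _; rewrite scalerA.
Qed.

Lemma lext_linear_fun (V : lmodType K) (f : nat -> {poly K} -> V) p :
  (forall a, linear (f a)) -> linear (fun q => lext (f^~ q) p).
Proof.
move=> fL c q r; rewrite /lext scaler_sumr -big_split; apply: eq_bigr => a _ /=.
by rewrite fL scalerDr !scalerA mulrC.
Qed.

Lemma L_mul_linearr p : linear (L_mul p).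
Proof.
move=> c q r; rewrite !L_mulE.
exact: (lext_linear_fun p (fun a => lext_linear _)).
Qed.

Lemma L_mul_linearl q : linear (L_mul^~ q).
Proof. by move=> c p r; rewrite !L_mulE lext_linear. Qed.

Lemma E_def n : E (n%:Z - 1) = 'X^n.
Proof. by rewrite /E subrK. Qed.

Lemma L_mulXX a b : L_mul 'X^a 'X^b = basis_mul (a%:Z - 1) (b%:Z - 1).
Proof. by rewrite L_mulE !lextX. Qed.

Lemma L_mul_basis (i j : int) : -1 <= i -> -1 <= j ->
  L_mul (E i) (E j) = (binz (i + j + 1) (i + 1))%:R *: E (i + j).
Proof.
have idx (k : int) : -1 <= k -> exists n : nat, k = n%:Z - 1.
  move=> k1; exists (absz (k + 1)).
  by rewrite gez0_abs ?addrK // -lerBlDr sub0r.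
by move=> /idx[a ->] /idx[b ->]; rewrite !E_def L_mulXX.
Qed.

Lemma basis_mulS a b :
  basis_mul (a%:Z - 1) (b.+1%:Z - 1) = 'C(a + b, a)%:R *: 'X^(a + b).
Proof.
have -> : b.+1%:Z - 1 = b by rewrite intS addrAC subrr add0r.
by rewrite /basis_mul subrK addrAC subrK -PoszD addrAC -PoszD E_def.
Qed.

Lemma basis_mul0 a : basis_mul (a%:Z - 1) (0%:Z - 1) = 0.
Proof.
rewrite /basis_mul !subrK; case: a => [|a]; first by rewrite scale0r.
have -> : a.+1%:Z - 1 + (0%:Z - 1) + 1 = a.
  by rewrite sub0r subrK intS addrAC subrr add0r.
by rewrite /= bin_small // scale0r.
Qed.

(* L in terms of the divided power product [dmul] and its derivation
   [drop_poly 1]. *)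
Definition dmul (p q : {poly K}) : {poly K} :=
  lext (fun a => lext (fun b => 'C(a + b, a)%:R *: 'X^(a + b)) q) p.

Lemma dmulr p : linear (dmul p).
Proof. exact: (lext_linear_fun p (fun a => lext_linear _)). Qed.

Lemma dmull q : linear (dmul^~ q).
Proof. by move=> c p r; rewrite /dmul lext_linear. Qed.

Lemma dmulXX a b : dmul 'X^a 'X^b = 'C(a + b, a)%:R *: 'X^(a + b).
Proof. by rewrite /dmul !lextX. Qed.

Lemma dmul0l q : dmul 0 q = 0.
Proof.
by have := dmull q (-1) 0 0; rewrite scaler0 addr0 => ->; rewrite scaleN1r addNr.
Qed.

Lemma dmul0r p : dmul p 0 = 0.
Proof.
by have := dmulr p (-1) 0 0; rewrite scaler0 addr0 => ->; rewrite scaleN1r addNr.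
Qed.

Lemma dmulZl c p q : dmul (c *: p) q = c *: dmul p q.
Proof. by have := dmull q c p 0; rewrite addr0 dmul0l addr0. Qed.

Lemma dmulZr c p q : dmul p (c *: q) = c *: dmul p q.
Proof. by have := dmulr p c q 0; rewrite addr0 dmul0r addr0. Qed.

Lemma dmulDr p q r : dmul p (q + r) = dmul p q + dmul p r.
Proof. by have := dmulr p 1 q r; rewrite !scale1r. Qed.

Lemma dmulC p q : dmul p q = dmul q p.
Proof.
apply: (poly_linear_ext (dmull q) (dmulr q)) => a.
apply: (poly_linear_ext (dmulr _) (dmull _)) => b.
by rewrite !dmulXX addnC -[X in X%:R *: _]bin_sub ?leq_addl // addnK.
Qed.

Lemma dmulA p q r : dmul (dmul p q) r = dmul p (dmul q r).
Proof.
apply: (@poly_linear_ext _ _ (fun p => dmul (dmul p q) r)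
  (fun p => dmul p (dmul q r))) => [c u v|c u v|a]; rewrite ?dmull //.
apply: (@poly_linear_ext _ _ (fun q => dmul (dmul 'X^a q) r)
  (fun q => dmul 'X^a (dmul q r))) => [c u v|c u v|b];
  rewrite ?dmull ?dmulr ?dmull ?dmulr //.
apply: (@poly_linear_ext _ _ (fun r => dmul (dmul 'X^a 'X^b) r)
  (fun r => dmul 'X^a (dmul 'X^b r))) => [c u v|c u v|c]; rewrite ?dmulr //.
rewrite !dmulXX dmulZl dmulZr !dmulXX !scalerA addnA -!natrM; congr (_%:R *: _).
have P : (0 < a`! * b`! * c`!)%N by rewrite !muln_gt0 !fact_gt0.
apply/eqP; rewrite -(eqn_pmul2r P); apply/eqP.
transitivity ((a + b + c)`!).
  rewrite -(@bin_fact (a + b + c) (a + b)) ?leq_addr // addKn.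
  by rewrite -(@bin_fact (a + b) a) ?leq_addr // addKn; ring.
rewrite -(@bin_fact (a + b + c) a) -?addnA ?leq_addr // addKn.
by rewrite -(@bin_fact (b + c) b) ?leq_addr // addKn; ring.
Qed.

Lemma shift_linear : linear (@drop_poly K 1).
Proof. by move=> c p q; rewrite drop_polyD drop_polyZ. Qed.

Lemma shiftXS n : drop_poly 1 'X^(n.+1) = 'X^n :> {poly K}.
Proof. by apply/polyP => i; rewrite coef_drop_poly !coefXn addn1 eqSS. Qed.

Lemma shiftX0 : drop_poly 1 'X^0 = 0 :> {poly K}.
Proof. by apply/polyP => i; rewrite coef_drop_poly !coefXn addn1 coef0. Qed.

Lemma L_mul_dmul p q : L_mul p q = dmul p (drop_poly 1 q).
Proof.
apply: (@poly_linear_ext _ _ (L_mul^~ q) (fun p => dmul p (drop_poly 1 q)))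
  => [|c u v|a]; rewrite ?dmull //; first exact: L_mul_linearl.
apply: (@poly_linear_ext _ _ (L_mul 'X^a) (fun q => dmul 'X^a (drop_poly 1 q)))
  => [|c u v|b]; rewrite ?shift_linear ?dmulr //; first exact: L_mul_linearr.
rewrite L_mulXX; case: b => [|b].
  by rewrite basis_mul0 shiftX0 dmul0r.
by rewrite basis_mulS shiftXS dmulXX.
Qed.

Lemma shift_dmul p q :
  drop_poly 1 (dmul p q) = dmul (drop_poly 1 p) q + dmul p (drop_poly 1 q).
Proof.
apply: (@poly_linear_ext _ _ (fun p => drop_poly 1 (dmul p q))
  (fun p => dmul (drop_poly 1 p) q + dmul p (drop_poly 1 q))) => [c u v|c u v|a].
- by rewrite dmull shift_linear.
- by rewrite shift_linear !dmull scalerDr addrACA.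
apply: (@poly_linear_ext _ _ (fun q => drop_poly 1 (dmul 'X^a q))
  (fun q => dmul (drop_poly 1 'X^a) q + dmul 'X^a (drop_poly 1 q)))
  => [c u v|c u v|b].
- by rewrite dmulr shift_linear.
- by rewrite shift_linear !dmulr scalerDr addrACA.
rewrite dmulXX drop_polyZ; case: a b => [|a] [|b]; rewrite ?shiftX0.
- by rewrite dmul0l dmul0r scaler0 addr0.
- by rewrite dmul0l add0r !add0n shiftXS dmulXX !bin0.
- by rewrite dmul0r addr0 !addn0 shiftXS dmulXX addn0 !binn.
rewrite (shiftXS a) (shiftXS b) !dmulXX addSnnS !addnS shiftXS.
by rewrite addSn binS natrD scalerDl addrC.
Qed.

Definition L_algebra : algebra K := Algebra L_mul_linearr L_mul_linearl.

Lemma L_rcomm p q r : L_mul (L_mul p q) r = L_mul (L_mul p r) q.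
Proof. by rewrite !L_mul_dmul !dmulA [dmul (drop_poly _ q) _]dmulC. Qed.

Lemma L_associator p q r : associator (A := L_algebra) p q r
  = - dmul (dmul p q) (drop_poly 1 (drop_poly 1 r)).
Proof.
rewrite /associator /= !L_mul_dmul shift_dmul dmulDr !dmulA opprD addrA subrr.
by rewrite sub0r.
Qed.

Lemma L_novikov : is_novikov L_algebra.
Proof.
by split=> [p q r|]; [rewrite !L_associator [dmul p q]dmulC | exact: L_rcomm].
Qed.

Definition L : novikovAlgebra K := NovikovAlgebra L_novikov.

End L.

Record bimodule (K : fieldType) (R : algebra K) := Bimodule {
  bimodule_space :> lmodType K;
  lact : R -> bimodule_space -> bimodule_space;
  ract : bimodule_space -> R -> bimodule_space;
  lact_linearr : forall r, linear (lact r);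
  lact_linearl : forall m, linear (lact^~ m);
  ract_linearr : forall m, linear (ract m);
  ract_linearl : forall r, linear (ract^~ r) }.

Section ZeroSplitExtension.
Variables (K : fieldType) (R : algebra K) (M : bimodule R).

Definition zse_mul (x y : R * M) : R * M :=
  (amul x.1 y.1, lact x.1 y.2 + ract x.2 y.1).

Fact zse_linearr x : linear (zse_mul x).
Proof.
move=> c y z; congr (_, _); rewrite /= ?amul_linearr //.
by rewrite lact_linearr ract_linearr scalerDr addrACA.
Qed.

Fact zse_linearl y : linear (zse_mul^~ y).
Proof.
move=> c x z; congr (_, _); rewrite /= ?amul_linearl //.
by rewrite lact_linearl ract_linearl scalerDr addrACA.
Qed.

Definition zero_split_extension : algebra K := Algebra zse_linearr zse_linearl.

End ZeroSplitExtension.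

Section N.
Variable K : fieldType.

(* {poly_2 K}, the polynomials of size at most 2, is the subspace of L spanned
   by E_(-1) and E_0. *)
Lemma R_span (p : {poly K}) :
  p \is a poly_of_size 2 <-> exists a b, p = a *: E K (-1) + b *: E K 0.
Proof.
rewrite -[E K 0]/'X^1 -[E K (-1)]/'X^0; split=> [p2|[a [b ->]]].
  exists p`_0, p`_1; rewrite -[LHS]coefK poly_def.
  transitivity (lext (fun i => 'X^i) p); first by [].
  by rewrite (lextE _ p2) !big_ord_recl big_ord0 addr0.
by apply: rpredD; apply: rpredZ;
  rewrite -[_ \in _]/(size ('X^_ : {poly K}) <= 2)%N size_polyXn.
Qed.

Lemma size_R_mul (r s : {poly_2 K}) : L_mul r s \is a poly_of_size 2.
Proof.
rewrite L_mulE (@lextE _ _ _ 2) ?size_npoly //.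
apply: rpred_sum => a _; apply: rpredZ.
rewrite (@lextE _ _ _ 2) ?size_npoly //.
apply: rpred_sum => b _; apply: rpredZ.
case: b => [[|[|//]] b2] /=; first by rewrite basis_mul0 rpred0.
rewrite basis_mulS addn0; apply: rpredZ.
rewrite -[_ \in _]/(size ('X^a : {poly K}) <= 2)%N size_polyXn.
  exact: ltn_ord.
Qed.

Definition R_mul (r s : {poly_2 K}) : {poly_2 K} := NPoly (size_R_mul r s).

Fact R_linearr r : linear (R_mul r).
Proof. by move=> c s t; apply: val_inj; rewrite /= L_mul_linearr. Qed.

Fact R_linearl s : linear (R_mul^~ s).
Proof. by move=> c r t; apply: val_inj; rewrite /= L_mul_linearl. Qed.

Definition R : algebra K := Algebra R_linearr R_linearl.

(* M has the vector space of L, F_i being the copy of E_i. *)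
Definition M_lact (r : R) (m : {poly K}) : {poly K} := L_mul (polyn r) m.
Definition M_ract (m : {poly K}) (r : R) : {poly K} := L_mul m (polyn r).

Fact M_lact_linearl m : linear (M_lact^~ m).
Proof. by move=> c r s; rewrite /M_lact /= L_mul_linearl. Qed.

Fact M_ract_linearr m : linear (M_ract m).
Proof. by move=> c r s; rewrite /M_ract /= L_mul_linearr. Qed.

Definition M : bimodule R :=
  @Bimodule K R {poly K} M_lact M_ract (fun r => L_mul_linearr (polyn r))
    M_lact_linearl M_ract_linearr (fun r => L_mul_linearl (polyn r)).

Lemma L_mulDr (p q r : {poly K}) : L_mul p (q + r) = L_mul p q + L_mul p r.
Proof. by have := L_mul_linearr p 1 q r; rewrite !scale1r. Qed.

Lemma L_mulDl (p q r : {poly K}) : L_mul (q + r) p = L_mul q p + L_mul r p.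
Proof. by have := L_mul_linearl p 1 q r; rewrite !scale1r. Qed.

Lemma N_novikov : is_novikov (zero_split_extension M).
Proof.
have asE (x y z : zero_split_extension M) :
    (associator x y z).2
    = associator (A := L K) (polyn x.1) (polyn y.1) z.2
      + (associator (A := L K) (polyn x.1) y.2 (polyn z.1)
         + associator (A := L K) x.2 (polyn y.1) (polyn z.1)).
  rewrite /associator /= /M_lact /M_ract /= L_mulDl L_mulDr !opprD.
  rewrite -!addrA; congr (_ + _).
  by rewrite !addrA [LHS](ACl (3*1*4*2*5))%AC.
have [lsym _] := L_novikov K.
split=> x y z.
  rewrite [LHS]surjective_pairing [RHS]surjective_pairing; congr (_, _).
    by apply: val_inj; exact: lsym (polyn x.1) (polyn y.1) (polyn z.1).
  rewrite !asE lsym; congr (_ + _); rewrite addrC; congr (_ + _); exact: lsym.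
congr (_, _); first by apply: val_inj => /=; apply: L_rcomm.
rewrite /= /M_lact /M_ract /= !L_mulDl.
rewrite [L_mul (L_mul _ y.2) _]L_rcomm [L_mul (L_mul x.2 _) _]L_rcomm.
rewrite [L_mul (L_mul _ _) z.2]L_rcomm.
by rewrite addrCA.
Qed.

Definition N : novikovAlgebra K := NovikovAlgebra N_novikov.

Lemma commutator_span_N (x : N) : commutator_span N x -> (polyn x.1)`_1 = 0.
Proof.
have L1 (p q : {poly K}) : (size p <= 2)%N -> (size q <= 2)%N ->
    (L_mul p q)`_1 = p`_1 * q`_1.
  move=> p2 q2; rewrite L_mulE (lextE _ p2) !big_ord_recl big_ord0 /=.
  rewrite !(lextE _ q2) !big_ord_recl !big_ord0 /= !basis_mul0.
  rewrite !(basis_mulS _ 0 0) !(basis_mulS _ 1 0) !coefE /= !bin0 !binn.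
  by rewrite !(mulr0, mulr1, addr0, add0r).
case=> s sP ->.
have zsum (t : seq (K * N)) : (forall p, p \in t -> (polyn p.2.1)`_1 = 0) ->
    (polyn (\sum_(p <- t) p.1 *: p.2).1)`_1 = 0.
  elim: t => [|p t IHt] tP; first by rewrite big_nil /= coef0.
  rewrite big_cons /= coefD coefZ tP ?mem_head // mulr0 add0r.
  by apply: IHt => q qt; apply: tP; rewrite inE qt orbT.
apply: zsum => p /sP [u _ [v _ <-]].
by rewrite /= coefB !L1 ?size_npoly // mulrC subrr.
Qed.

(* [N, N] is an algebra for the product of N. *)
Lemma commutator_span_N_mul_closed (x y : N) :
  commutator_span N x -> commutator_span N y ->
  commutator_span N (amul x y).
Proof.
move=> /commutator_span_N x0 /commutator_span_N y0.
have LC (r : {poly_2 K}) : (polyn r)`_1 = 0 -> polyn r = (polyn r)`_0 *: 'X^0.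
  move=> r1; rewrite -[LHS]coefK poly_def.
  transitivity (lext (fun i => 'X^i) r); first by [].
  rewrite (lextE _ (size_npoly r)) !big_ord_recl big_ord0 /=.
  by rewrite [bump 0 0]/= r1 scale0r !addr0.
have L0 (p : {poly K}) (r : {poly_2 K}) : (polyn r)`_1 = 0 -> L_mul p r = 0.
  move=> /LC ->; rewrite L_mul_dmul drop_polyZ shiftX0 scaler0.
  by rewrite dmul0r.
have L00 (p : {poly K}) : L_mul p 0 = 0.
  by rewrite L_mul_dmul drop_poly0r dmul0r.
pose r : N := (x.1, 0); pose m : N := (0, y.2).
exists [:: (1, commutator r m)].
  by move=> _ /[1!inE] /eqP -> /=; exists r => //; exists m.
rewrite big_seq1 scale1r; congr (_, _).
  apply: val_inj; rewrite /= (L0 _ _ y0).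
  by rewrite L00 (L0 _ _ x0) subrr.
rewrite /= /M_lact /M_ract !L00 (L0 _ _ y0) (L0 _ _ x0).
by rewrite !addr0 subr0.
Qed.

End N.

(* Main.v *)
Require Import Defs.
From mathcomp Require Import all_boot all_order all_algebra.
From mathcomp Require Import classical_sets.

(** In divided powers, E_(n - 1) is x^n / n! and the product of L is
    p o q = p q', where ' is the derivation d/dx; so R is spanned by 1 and x,
    and the nonzero commutators of N are determined by [1, x] = 1 and
    [r, m] = r m' - m r' for r in R and m in M.

    Lie solvability: p' = 0 for p in K.1, so commutators of elements of
    K.1 + M lie in M, and any two elements of M commute.  Since every
    commutator of N is in K.1 + M, the derived series descends at least as fast
    as N, K.1 + M, M, 0.

    Both lower bounds come from the element 1 of R: for m in M, m o 1 = 0 and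
    1 o m = m', so [1, m] = 1 o m = m'.  This map sends F_j to F_(j - 1), so it
    is onto M over every field (whereas x^n -> n x^(n - 1) is not onto K[x] in
    positive characteristic).  Since 1 = [1, x] is in [N, N], the second derived
    algebra still contains M (lemma [derived_M]); and, multiplying by 1 again
    and again, every power of [N, N] contains M
    (lemma [apow_commutator_span_M]). *)

Import GRing.Theory.
Local Open Scope ring_scope.
Local Open Scope classical_set_scope.

Section Spans.
Variables (K : fieldType) (A : algebra K).
Implicit Types (S B C P : set A) (x y z : A).

Lemma lspan0 S : lspan S 0.
Proof. by exists [::]; rewrite ?big_nil. Qed.

Lemma mem_lspan S x : S x -> lspan S x.
Proof.
move=> Sx; exists [:: (1, x)]; last by rewrite big_seq1 scale1r.
by move=> p; rewrite inE => /eqP ->.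
Qed.

Lemma lspan_min S P :
  P 0 -> (forall a x y, P x -> P y -> P (a *: x + y)) -> S `<=` P ->
  lspan S `<=` P.
Proof.
move=> P0 PL SP _ [s sS ->]; elim: s sS => [|p s IHs] sS.
  by rewrite big_nil.
rewrite big_cons; apply: PL; first by apply/SP/sS; rewrite mem_head.
by apply: IHs => q qs; apply: sS; rewrite inE qs orbT.
Qed.

Lemma mem_sprod B C x y : B x -> C y -> sprod B C (amul x y).
Proof. by move=> Bx Cy; apply: mem_lspan; exists x => //; exists y. Qed.

Lemma sprod_min B C P :
  P 0 -> (forall a x y, P x -> P y -> P (a *: x + y)) ->
  (forall x y, B x -> C y -> P (amul x y)) -> sprod B C `<=` P.
Proof.
move=> P0 PL BCP; apply: lspan_min => // _ [x Bx [y Cy <-]]; exact: BCP.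
Qed.

(** B B^m is one of the summands of B^(m + 1). *)
Lemma apow_mull B m x y :
  (0 < m)%N -> B x -> apow B m y -> apow B m.+1 (amul x y).
Proof.
move=> m0 Bx By; rewrite apowE //.
exists (fun i => if i == 1%N then amul x y else 0).
  move=> i _; case: eqP => [->|_]; last exact: lspan0.
  by rewrite subn1; apply: mem_sprod.
by rewrite big_ltn // big_nat big1 ?addr0 // => -[|[|i]].
Qed.

End Spans.

Section Proposition.
Variable K : fieldType.

Fact size_X_lt2 (i : 'I_2) : ('X^i : {poly K}) \is a poly_of_size 2.
Proof. by rewrite -[_ \in _]/(size ('X^i : {poly K}) <= 2)%N size_polyXn. Qed.

(** The element E_(i - 1) of R. *)
Definition R_basis (i : 'I_2) : N K := (NPoly (size_X_lt2 i), 0).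

Definition N_one : N K := R_basis ord0.

Definition inM (m : {poly K}) : N K := (0, m).

Lemma L_mul0l (p : {poly K}) : L_mul 0 p = 0.
Proof. by rewrite L_mul_dmul dmul0l. Qed.

Lemma L_mul0r (p : {poly K}) : L_mul p 0 = 0.
Proof. by rewrite L_mul_dmul drop_poly0r dmul0r. Qed.

Lemma L_mul1X n : L_mul 'X^0 'X^(n.+1) = 'X^n :> {poly K}.
Proof. by rewrite L_mul_dmul shiftXS dmulXX bin0 scale1r. Qed.

Lemma L_mulX0 (p : {poly K}) : L_mul p 'X^0 = 0.
Proof. by rewrite L_mul_dmul shiftX0 dmul0r. Qed.

(** The derivative of a constant vanishes. *)
Lemma L_mul_const (p : {poly K}) (r : {poly_2 K}) :
  (polyn r)`_1 = 0 -> L_mul p r = 0.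
Proof.
move=> r1; rewrite L_mul_dmul.
suff -> : drop_poly 1 r = 0 :> {poly K} by rewrite dmul0r.
apply/polyP => -[|i]; rewrite coef_drop_poly coef0 addn1 //.
by rewrite nth_default // (leq_trans (size_npoly r)).
Qed.

Lemma N_one_mul n : amul N_one (inM 'X^(n.+1)) = inM 'X^n.
Proof.
congr (_, _); first by apply: val_inj; apply: L_mul0r.
by rewrite /= /M_lact /M_ract L_mul1X L_mul0l addr0.
Qed.

Lemma N_mul_one n : amul (inM 'X^n) N_one = 0.
Proof.
congr (_, _); first by apply: val_inj; apply: L_mul0l.
by rewrite /= /M_lact /M_ract L_mul0r add0r L_mulX0.
Qed.

Lemma commutator_one_M n : commutator N_one (inM 'X^(n.+1)) = inM 'X^n.
Proof. by rewrite /commutator N_one_mul N_mul_one subr0. Qed.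

Lemma commutator_R_basis : commutator N_one (R_basis (lift ord0 ord0)) = N_one.
Proof.
congr (_, _); last by rewrite /= /M_lact /M_ract !L_mul0l !L_mul0r addr0 subr0.
by apply: val_inj; rewrite /= L_mul1X L_mulX0 subr0.
Qed.

Lemma inM_neq0 n : inM 'X^n <> 0.
Proof. by case=> /eqP; rewrite -size_poly_eq0 size_polyXn. Qed.

Local Notation NLie := (commutator_algebra (N K)).

Lemma derived1_sub (x : NLie) : derived 1 x -> (polyn x.1)`_1 = 0.
Proof.
(* The first term of the derived series is [N, N] verbatim. *)
exact: commutator_span_N.
Qed.

Lemma derived2_sub (x : NLie) : derived 2 x -> x.1 = 0.
Proof.
apply: (@sprod_min _ NLie _ _ (fun z => z.1 = 0)) => // [a y z /= -> ->|y z].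
  by rewrite scaler0 addr0.
move=> /derived1_sub y1 /derived1_sub z1.
by apply: val_inj; rewrite /= !L_mul_const ?subr0.
Qed.

Lemma derived3_sub (x : NLie) : derived 3 x -> x = 0.
Proof.
apply: (@sprod_min _ NLie _ _ [set 0]) => // [a y z /= -> ->|[y1 y2] [z1 z2]].
  by rewrite scaler0 addr0.
move=> /derived2_sub /= -> /derived2_sub /= ->; congr (_, _).
  by apply: val_inj; rewrite /= !L_mul0l subr0.
by rewrite /= /M_lact /M_ract /= !L_mul0l !L_mul0r addr0 subr0.
Qed.

Lemma derived_one n : (n <= 1)%N -> @derived _ NLie n N_one.
Proof.
case: n => [|[|]] // _.
by rewrite -commutator_R_basis; apply: (@mem_sprod _ NLie).
Qed.

Lemma derived_M n k : (n <= 2)%N -> @derived _ NLie n (inM 'X^k).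
Proof.
elim: n k => [|n IHn] k // n2; rewrite -commutator_one_M.
by apply: (@mem_sprod _ NLie); [apply: derived_one | apply: IHn; apply: ltnW].
Qed.

Lemma apow_commutator_span_M m k :
  (0 < m)%N -> apow (commutator_span (N K)) m (inM 'X^k).
Proof.
case: m => // m _; elim: m k => [|m IHm] k.
  exact: (derived_M 1 k).
rewrite -N_one_mul; apply: apow_mull => //.
exact: (derived_one 1).
Qed.

End Proposition.

Theorem proposition2 (K : fieldType) :
  lie_solvable_of_index (N K) 3 /\ ~ nilpotent (commutator_span (N K)).
Proof.
split; last first.
  case=> m m0 Nm0; apply: (@inM_neq0 K 0).
  by have := apow_commutator_span_M K m 0 m0; rewrite Nm0.
split.
  by apply/seteqP; split=> x => [/derived3_sub //|->]; apply: lspan0.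
move=> m Dm0; rewrite ltnNge; apply/negP => m2; apply: (@inM_neq0 K 0).
by have := @derived_M K m 0 m2; rewrite Dm0.
Qed.
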